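(* Every matrix $A\in U(3)$ has a biunimodular vector.
   Context: A biunimodular vector for $A\in U(n)$ is a vector $v\in\mathbb{C}^n$ such that both $v$ and $Av$ have all entries of modulus one. *)

(* Defs.v *)
From mathcomp Require Import all_boot all_order all_algebra.
From mathcomp Require Import reals complex.

Set Implicit Arguments.
Unset Strict Implicit.
Unset Printing Implicit Defensive.

Import Order.TTheory GRing.Theory Num.Theory.

Local Open Scope ring_scope.

Definition unimodular (R : realType) (n : nat) (v : 'cV[R[i]]_n) : Prop :=
  forall k : 'I_n, `|v k 0| = 1.

(* Used only for unitary [A]; [`|z|] is the modulus of [z], viewed in [R[i]]. *)
Definition biunimodular (R : realType) (n : nat)
    (A : 'M[R[i]]_n) (v : 'cV[R[i]]_n) : Prop :=
  unimodular v /\ unimodular (A *m v).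

(* Main.v *)
Require Import Defs.
From mathcomp Require Import all_boot all_order all_algebra.
From mathcomp Require Import reals complex.
From mathcomp Require Import boolp topology normedtype realfun.
From mathcomp Require Import ring lra.

Set Implicit Arguments.
Unset Strict Implicit.
Unset Printing Implicit Defensive.

Import Order.TTheory GRing.Theory Num.Theory.
Import numFieldNormedType.Exports.

Local Open Scope ring_scope.

(** Let [a], [b] be the first two rows of [A].  As [|v|^2 = |A v|^2 = 3], it
suffices to make the first two entries of [A v] unimodular.  After a change of
phases and a permutation of the columns, [a] is real and nonnegative with [a3]
minimal; write [v = (1, u, s)].  The torus vectors with [|a.v| = 1] form a
curve [C], stable under conjugation, and orthogonality of [a] and [b] makes the
imaginary parts of [b_i conj(b_j)] proportional to [a].  Let
[f(v) = |b.v|^2 - 1] and suppose that [f] has no zero on [C].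
- [C] is covered by two conjugate sheets over the arc of admissible [s]; [f]
  has a constant sign on each.  Either the sheets meet, or every [s] is
  admissible, and then the conjugation-odd part of [f], which changes sign
  between [s = 1] and [s = -1], excludes opposite signs.  So [f] has one sign
  on [C].
- The conjugation-even part of [f] is a combination of the real parts of
  [u], [u conj(s)], [s].  At the points of [C] with [u = s], [s = 1] and
  [u = 1] (the last replaced by [s = -1] when it does not exist) these vectors
  have a vanishing positive combination: contradiction. *)

(** * The curve [C] in real coordinates, and its two sheets *)

(* [(1, m + i n, c + i d)] is a torus vector [v] with [|a.v|^2 = |a|^2]. *)
Definition on_level (R : realType) (a1 a2 a3 m n c d : R) : Prop :=
  [/\ m ^+ 2 + n ^+ 2 = 1, c ^+ 2 + d ^+ 2 = 1 &
      a1 * a2 * m + a2 * a3 * (m * c + n * d) + a1 * a3 * c = 0].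

(* Half of [|b.v|^2 - |b|^2] at [v = (1, m + i n, c + i d)], where [b_i conj(b_j)]
has real part [rij] and imaginary part [k * a_l], for [(i, j, l)] cyclic. *)
Definition cross_term (R : realType) (r12 r23 r31 a1 a2 a3 k m n c d : R) : R :=
  r12 * m + r23 * (m * c + n * d) + r31 * c
  - k * (a1 * (n * c - m * d) + a2 * d - a3 * n).

Lemma mul_gt0_of_no_zero (R : realType) (g : R -> R) (a b : R) :
  a <= b -> continuous g -> (forall x, a <= x <= b -> g x != 0) ->
  0 < g a * g b.
Proof.
move=> le_ab cont_g g_neq0; rewrite ltNge; apply/negP => gab_le0.
have [||x xab gx0] := @IVT R g a b 0 le_ab.
- exact: continuous_subspaceT.
- rewrite ge_min le_max.
  by have [ga|ga] := lerP (g a) 0; have [gb|gb] := lerP (g b) 0;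
    rewrite ?orbT //=; nra.
- by have := g_neq0 x; rewrite gx0 eqxx; move: xab; rewrite in_itv /= => -> /(_ isT).
Qed.

(* [|a1 + a3 s|^2] for [|s| = 1] and [Re s = c]. *)
Definition path_norm (R : realType) (a1 a3 c : R) : R :=
  a1 ^+ 2 + a3 ^+ 2 + 2 * a1 * a3 * c.

(** [N = 0] would force [K = 0], hence [a3 * c = 0], and then [N] would be at least [a1 ^+ 2]. This
    allows division by [N] along a sheet. *)
Lemma path_norm_gt0 (R : realType) (a1 a2 a3 K c : R) :
  0 < a1 -> a2 * K = - (a1 * a3 * c) -> c ^+ 2 <= 1 ->
  K ^+ 2 <= path_norm a1 a3 c -> 0 < path_norm a1 a3 c.
Proof.
move=> a1_gt0 aK c_le1 K_le; rewrite lt_neqAle (le_trans (sqr_ge0 K) K_le) andbT.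
apply/eqP => N0; move: K_le; rewrite -N0 => K_le.
have K0 : K = 0 by apply/eqP; rewrite -sqrf_eq0 eq_le K_le sqr_ge0.
have a3c : a3 * c = 0.
  apply/(mulfI (lt0r_neq0 a1_gt0)); move: aK; rewrite K0; lra.
have := exprn_gt0 2 a1_gt0; have := sqr_ge0 a3.
by move: N0; rewrite /path_norm -[2 * a1 * a3 * c]mulrA a3c; lra.
Qed.

(* For given [s], the equation of [on_level] reads
[Re (conj(u) (a1 + a3 s)) = K]; hence [u = (a1 + a3 s) (K + i S) / N], where
[N = |a1 + a3 s|^2] and [S^2 = N - K^2]. *)
Lemma path_on_level (R : realType) (a1 a2 a3 K S N c d : R) :
  a2 * K = - (a1 * a3 * c) -> N = path_norm a1 a3 c -> N != 0 ->
  S ^+ 2 = N - K ^+ 2 -> c ^+ 2 + d ^+ 2 = 1 ->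
  on_level a1 a2 a3 (((a1 + a3 * c) * K - a3 * d * S) / N)
    ((a3 * d * K + (a1 + a3 * c) * S) / N) c d.
Proof.
move=> aK defN N0 S2 cd.
have defN' : (a1 + a3 * c) ^+ 2 + (a3 * d) ^+ 2 = N.
  rewrite defN /path_norm.
  transitivity (a1 ^+ 2 + 2 * a1 * a3 * c + a3 ^+ 2 * (c ^+ 2 + d ^+ 2)); first by ring.
  by rewrite cd; ring.
split=> //.
- rewrite !expr_div_n -mulrDl.
  suff -> : ((a1 + a3 * c) * K - a3 * d * S) ^+ 2
    + (a3 * d * K + (a1 + a3 * c) * S) ^+ 2 = N ^+ 2 by rewrite divff // expf_neq0.
  transitivity (((a1 + a3 * c) ^+ 2 + (a3 * d) ^+ 2) * (K ^+ 2 + S ^+ 2)); first by ring.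
  by rewrite defN' S2; ring.
- transitivity (a2 * K * (((a1 + a3 * c) ^+ 2 + (a3 * d) ^+ 2) / N) + a1 * a3 * c);
    first by ring.
  by rewrite defN' divff // aK; ring.
Qed.

(** Converse of the parametrization: [K] and [S] are the real and imaginary parts of
    [u conj(a1 + a3 s)], so [|u| = 1] gives the first equation, and multiplying by [a1 + a3 s]
    recovers [u N]. *)
Lemma level_in_path (R : realType) (a1 a2 a3 K S N m n c d : R) :
  a2 != 0 -> a2 * K = - (a1 * a3 * c) -> N = path_norm a1 a3 c ->
  on_level a1 a2 a3 m n c d -> S = n * (a1 + a3 * c) - m * (a3 * d) ->
  [/\ S ^+ 2 = N - K ^+ 2, m * N = (a1 + a3 * c) * K - a3 * d * S &
      n * N = a3 * d * K + (a1 + a3 * c) * S].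
Proof.
move=> a20 aK defN [mn cd E] defS.
have defN' : (a1 + a3 * c) ^+ 2 + (a3 * d) ^+ 2 = N.
  rewrite defN /path_norm.
  transitivity (a1 ^+ 2 + 2 * a1 * a3 * c + a3 ^+ 2 * (c ^+ 2 + d ^+ 2)); first by ring.
  by rewrite cd; ring.
have defK : K = m * (a1 + a3 * c) + n * (a3 * d).
  by apply: (mulfI a20); rewrite aK; lra.
split; last 2 first.
- by rewrite -defN' defS defK; ring.
- by rewrite -defN' defS defK; ring.
transitivity (((a1 + a3 * c) ^+ 2 + (a3 * d) ^+ 2) * (m ^+ 2 + n ^+ 2) - K ^+ 2).
  by rewrite defS defK; ring.
by rewrite mn defN' mulr1.
Qed.

(** This is [N] times the cross term along a sheet: with the denominator cleared, continuity holds
    on the whole line, even where [N] vanishes. *)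
Lemma continuous_cross_path (R : realType) (r12 r23 r31 a1 a2 a3 k q e : R) :
  let N x := path_norm a1 a3 x in
  let K x := q * x in
  let S x := Num.sqrt (N x - K x ^+ 2) in
  let D x := e * Num.sqrt (1 - x ^+ 2) in
  let M x := (a1 + a3 * x) * K x - a3 * D x * S x in
  let L x := a3 * D x * K x + (a1 + a3 * x) * S x in
  continuous (fun x => r12 * M x + r23 * (M x * x + L x * D x) + r31 * (x * N x)
    - k * (a1 * (L x * x - M x * D x) + a2 * (D x * N x) - a3 * L x)).
Proof.
have cid : continuous (fun x : R => x) by move=> x; exact: cvg_id.
have cc (y : R) : continuous (fun x : R => y) by move=> x; exact: cvg_cst.
have cM (f g : R -> R) : continuous f -> continuous g -> continuous (fun x => f x * g x).
  by move=> cf cg x; apply: cvgM; [exact: cf|exact: cg].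
have cD (f g : R -> R) : continuous f -> continuous g -> continuous (fun x => f x + g x).
  by move=> cf cg x; apply: cvgD; [exact: cf|exact: cg].
have cN (f : R -> R) : continuous f -> continuous (fun x => - f x).
  by move=> cf x; apply: cvgN; exact: cf.
have cS (f : R -> R) : continuous f -> continuous (fun x => Num.sqrt (f x)).
  by move=> cf x; apply: continuous_comp; [exact: cf|exact: sqrt_continuous].
move=> N K S D M L.
have contN : continuous N := cD _ _ (cc _) (cM _ _ (cc _) cid).
have contK : continuous K := cM _ _ (cc _) cid.
have contS : continuous S := cS _ (cD _ _ contN (cN _ (cM _ _ contK contK))).
have contD : continuous D :=
  cM _ _ (cc e) (cS _ (cD _ _ (cc 1) (cN _ (cM _ _ cid cid)))).
have cont_lin : continuous (fun x => a1 + a3 * x) :=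
  cD _ _ (cc _) (cM _ _ (cc _) cid).
have cont_a3D : continuous (fun x => a3 * D x) := cM _ _ (cc _) contD.
have contM : continuous M :=
  cD _ _ (cM _ _ cont_lin contK) (cN _ (cM _ _ cont_a3D contS)).
have contL : continuous L :=
  cD _ _ (cM _ _ cont_a3D contK) (cM _ _ cont_lin contS).
apply: (cD _ _ (cD _ _ (cD _ _ (cM _ _ (cc r12) contM) _) _)
  (cN _ (cM _ _ (cc k) (cD _ _ (cD _ _ (cM _ _ (cc a1) _) _) _)))).
- exact: (cM _ _ (cc r23) (cD _ _ (cM _ _ contM cid) (cM _ _ contL contD))).
- exact: (cM _ _ (cc r31) (cM _ _ cid contN)).
- exact: (cD _ _ (cM _ _ contL cid) (cN _ (cM _ _ contM contD))).
- exact: (cM _ _ (cc a2) (cM _ _ contD contN)).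
- exact: (cN _ (cM _ _ (cc a3) contL)).
Qed.

Lemma cross_term_path (R : realType) (r12 r23 r31 a1 a2 a3 k m n c d N : R) :
  N != 0 ->
  r12 * m + r23 * (m * c + n * d) + r31 * (c * N)
    - k * (a1 * (n * c - m * d) + a2 * (d * N) - a3 * n)
  = cross_term r12 r23 r31 a1 a2 a3 k (m / N) (n / N) c d * N.
Proof. by move=> N0; rewrite /cross_term; field. Qed.

(* The sign of [Im (u conj(a1 + a3 s))] tells the sheet; each sheet is connected
to its point over [s = 1], because [N - K^2] is a concave function of [Re s]. *)
Lemma same_sign_as_base (R : realType)
    (r12 r23 r31 a1 a2 a3 k m n c d m0 : R) :
  0 < a1 -> 0 < a2 -> 0 <= a3 -> a1 * a3 <= a2 * (a1 + a3) ->
  (forall m' n' c' d', on_level a1 a2 a3 m' n' c' d' ->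
    cross_term r12 r23 r31 a1 a2 a3 k m' n' c' d' != 0) ->
  on_level a1 a2 a3 m n c d -> 0 <= n * (a1 + a3 * c) - m * (a3 * d) ->
  a2 * (a1 + a3) * m0 = - (a1 * a3) ->
  0 < cross_term r12 r23 r31 a1 a2 a3 k m n c d
      * cross_term r12 r23 r31 a1 a2 a3 k m0 (Num.sqrt (1 - m0 ^+ 2)) 1 0.
Proof.
move=> a1_gt0 a2_gt0 a3_ge0 a_le cross_neq0 level S_ge0 defm0.
have a20 := lt0r_neq0 a2_gt0.
have [mn cd _] := level.
pose q := - (a1 * a3 / a2).
(* [Im s] keeps the sign of [d] along the path from [Re s = c] to [Re s = 1]. *)
pose e : R := if 0 <= d then 1 else -1.
pose N := path_norm a1 a3.
pose K x := q * x.
pose S x := Num.sqrt (N x - K x ^+ 2).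
pose D x := e * Num.sqrt (1 - x ^+ 2).
pose M x := (a1 + a3 * x) * K x - a3 * D x * S x.
pose L x := a3 * D x * K x + (a1 + a3 * x) * S x.
pose G x := r12 * M x + r23 * (M x * x + L x * D x) + r31 * (x * N x)
  - k * (a1 * (L x * x - M x * D x) + a2 * (D x * N x) - a3 * L x).
have cont_G : continuous G := @continuous_cross_path R r12 r23 r31 a1 a2 a3 k q e.
have aK x : a2 * K x = - (a1 * a3 * x) by rewrite /K /q; field.
have [c_gtN1 c_le1] : -1 <= c /\ c <= 1.
  by split; have := sqr_ge0 d; nra.
have N_gt0 x : -1 <= x <= 1 -> K x ^+ 2 <= N x -> 0 < N x.
  move=> x1 hx; apply: path_norm_gt0 (aK x) _ hx => //; nra.
have h1 : K 1 ^+ 2 <= N 1.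
  rewrite -subr_ge0 -(pmulr_rge0 _ (exprn_gt0 2 a2_gt0)).
  have -> : a2 ^+ 2 * (N 1 - K 1 ^+ 2) = (a2 * (a1 + a3)) ^+ 2 - (a2 * K 1) ^+ 2.
    by rewrite /N /path_norm; ring.
  rewrite aK mulr1 subr_ge0 sqrrN ler_sqr ?nnegrE //.
    by rewrite mulr_ge0 // ltW.
  by rewrite mulr_ge0 ?addr_ge0 // ltW.
have [S2c mE nE] := level_in_path a20 (aK c) (erefl (N c)) level (erefl _).
have hc : K c ^+ 2 <= N c by rewrite -subr_ge0 -S2c sqr_ge0.
have hx x : c <= x <= 1 -> K x ^+ 2 <= N x.
  move=> /andP[cx]; rewrite le_eqVlt => /predU1P[->//|x1].
  have cx1 : 0 < 1 - c by rewrite subr_gt0 (le_lt_trans cx).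
  rewrite -subr_ge0 -(pmulr_rge0 _ cx1).
  (* Concavity made explicit: [N] is affine, and the last term is the gap between [x ^+ 2] and its
     chord over [[c, 1]], times [q ^+ 2 * (1 - c)]. *)
  have -> : (1 - c) * (N x - K x ^+ 2) = (1 - x) * (N c - K c ^+ 2)
      + (x - c) * (N 1 - K 1 ^+ 2) + q ^+ 2 * ((1 - x) * (x - c) * (1 - c)).
    by rewrite /N /K /path_norm; ring.
  have x1' : 0 <= 1 - x by rewrite subr_ge0 ltW.
  have cx' : 0 <= x - c by rewrite subr_ge0.
  have cx1' := ltW cx1.
  rewrite -subr_ge0 in hc; rewrite -subr_ge0 in h1.
  have t1 := mulr_ge0 x1' hc; have t2 := mulr_ge0 cx' h1.
  have t3 := mulr_ge0 (sqr_ge0 q) (mulr_ge0 (mulr_ge0 x1' cx') cx1').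
  exact: addr_ge0 (addr_ge0 t1 t2) t3.
have Scross x : c <= x <= 1 ->
  0 < N x /\ G x = cross_term r12 r23 r31 a1 a2 a3 k (M x / N x) (L x / N x) x (D x) * N x.
  move=> /andP[cx x1]; have Nx : 0 < N x.
    by apply: N_gt0; [rewrite x1 (le_trans c_gtN1) | apply: hx; rewrite cx].
  by split=> //; rewrite /G cross_term_path // lt0r_neq0.
have : 0 < G c * G 1.
  apply: mul_gt0_of_no_zero => // x xb; have [Nx ->] := Scross x xb.
  apply: mulf_neq0; last exact: lt0r_neq0.
  apply: cross_neq0.
  apply: path_on_level => //; first exact: lt0r_neq0.
  - by rewrite /S sqr_sqrtr // subr_ge0; exact: hx.
  - rewrite /D exprMn sqr_sqrtr; first by rewrite /e; case: ifP => _; ring.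
    by rewrite subr_ge0; nra.
(* At [x = c] the path passes through the given point: [e] fits the sign of [d], and [S_ge0] selects
   the nonnegative root. *)
have Dc : D c = d.
  rewrite /D -cd addrAC subrr add0r sqrtr_sqr /e; have [d0|d0] := leP 0 d.
    by rewrite mul1r ger0_norm.
  by rewrite ltr0_norm // mulN1r opprK.
have Sc : S c = n * (a1 + a3 * c) - m * (a3 * d).
  by rewrite /S -S2c sqrtr_sqr ger0_norm.
have D1 : D 1 = 0 by rewrite /D expr1n subrr sqrtr0 mulr0.
have c1 : c <= (1 : R) <= 1 by apply/andP.
have cc : c <= c <= 1 by apply/andP.
have [Nc ->] := Scross c cc; have [N1 ->] := Scross 1 c1.
have -> : M c / N c = m by rewrite /M Sc Dc -mE mulfK // lt0r_neq0.
have -> : L c / N c = n by rewrite /L Sc Dc -nE mulfK // lt0r_neq0.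
have a13_gt0 : 0 < a1 + a3 by rewrite ltr_wpDr.
have a130 := lt0r_neq0 a13_gt0.
have K1 : K 1 = (a1 + a3) * m0.
  by apply: (mulfI a20); rewrite aK mulr1 -defm0; ring.
have N1E : N 1 = (a1 + a3) ^+ 2 by rewrite /N /path_norm; ring.
have -> : M 1 / N 1 = m0 by rewrite /M D1 K1 N1E; field.
have -> : L 1 / N 1 = Num.sqrt (1 - m0 ^+ 2).
  rewrite /L D1 N1E /S N1E K1 exprMn -{1}[(a1 + a3) ^+ 2]mulr1 -mulrBr.
  by rewrite sqrtrM ?sqr_ge0 // sqrtr_sqr gtr0_norm //; field.
rewrite Dc D1 mulrACA pmulr_lgt0 //; exact: mulr_gt0.
Qed.

(** * A zero of the cross term on the curve *)

Lemma cross_term_conj (R : realType) (r12 r23 r31 a1 a2 a3 k m n c d : R) :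
  cross_term r12 r23 r31 a1 a2 a3 (- k) m n c d
  = cross_term r12 r23 r31 a1 a2 a3 k m (- n) c (- d).
Proof. by rewrite /cross_term; ring. Qed.

Lemma on_level_conj (R : realType) (a1 a2 a3 m n c d : R) :
  on_level a1 a2 a3 m n c d -> on_level a1 a2 a3 m (- n) c (- d).
Proof. by case=> mn cd E; split; rewrite ?sqrrN ?mulrNN. Qed.

Lemma sqr_sqrt1B (R : realType) (x y : R) :
  0 < y -> `|x| <= y -> (x / y) ^+ 2 + Num.sqrt (1 - (x / y) ^+ 2) ^+ 2 = 1.
Proof.
move=> y_gt0 xy; rewrite sqr_sqrtr ?subrKC // subr_ge0.
by rewrite -real_normK ?num_real // expr_le1 // normf_div (gtr0_norm y_gt0)
  ler_pdivrMr // mul1r.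
Qed.

(* A common point of the two sheets: [u] is a positive multiple of [a1 + a3 s],
and [|a1 + a3 s| = p] with [p = |a| - a2]. *)
Lemma on_level_aligned (R : realType) (a1 a2 a3 : R) :
  0 < a1 -> 0 < a2 -> 0 <= a3 -> a3 <= a1 -> a2 * (a1 - a3) <= a1 * a3 ->
  exists m n c d, on_level a1 a2 a3 m n c d /\
    n * (a1 + a3 * c) - m * (a3 * d) = 0.
Proof.
move=> a1_gt0 a2_gt0; rewrite le_eqVlt => /predU1P[<- _|a3_gt0 a31 ha].
  by rewrite subr0 mulr0 leNgt mulr_gt0.
pose s := Num.sqrt (a1 ^+ 2 + a2 ^+ 2 + a3 ^+ 2).
have s2 : s ^+ 2 = a1 ^+ 2 + a2 ^+ 2 + a3 ^+ 2.
  by rewrite sqr_sqrtr // !addr_ge0 ?sqr_ge0.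
have a2s : a2 < s.
  rewrite -[a2]gtr0_norm // -sqrtr_sqr ltr_sqrt; last by rewrite !addr_gt0 ?exprn_gt0.
  by rewrite addrAC ltrDr addr_gt0 ?exprn_gt0.
(* [p] is the positive root of the quadratic left after eliminating [c] from
   [a2 * p = - (a1 * a3 * c)] and [p ^+ 2 = path_norm a1 a3 c]. *)
pose p := s - a2; have p_gt0 : 0 < p by rewrite subr_gt0.
have p2 : p ^+ 2 + 2 * a2 * p = a1 ^+ 2 + a3 ^+ 2.
  transitivity (s ^+ 2 - a2 ^+ 2); first by rewrite /p; ring.
  by rewrite s2; ring.
have a13_gt0 : 0 < a1 * a3 by rewrite mulr_gt0.
(* This gives [|c| <= 1]. If it failed, [p] would be less than [a1 - a3], and [ha] would restore the
   bound. *)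
have a2p : a2 * p <= a1 * a3.
  rewrite leNgt; apply/negP => lt_p.
  have : p < a1 - a3.
    rewrite -ltr_sqr ?nnegrE ?subr_ge0 //; last exact: ltW.
    have -> : (a1 - a3) ^+ 2 = a1 ^+ 2 + a3 ^+ 2 - 2 * (a1 * a3) by ring.
    by rewrite -p2; lra.
  by rewrite -(ltr_pM2l a2_gt0) => /lt_le_trans /(_ ha); rewrite ltNge ltW.
pose c := (- (a2 * p)) / (a1 * a3); pose d := Num.sqrt (1 - c ^+ 2).
have cd : c ^+ 2 + d ^+ 2 = 1.
  by apply: sqr_sqrt1B; rewrite // normrN ger0_norm // mulr_ge0 // ltW.
have a13 : a1 * a3 * c = - (a2 * p) by rewrite mulrC divfK // lt0r_neq0.
have aK : a2 * p = - (a1 * a3 * c) by rewrite a13 opprK.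
have defN : p ^+ 2 = path_norm a1 a3 c.
  by rewrite /path_norm -!mulrA [a1 * _]mulrA a13 -p2; ring.
(* The formulas of [path_on_level] with [K = p], [S = 0] and [N = p ^+ 2]. *)
exists (((a1 + a3 * c) * p - a3 * d * 0) / p ^+ 2).
exists ((a3 * d * p + (a1 + a3 * c) * 0) / p ^+ 2).
exists c, d; split; last by ring.
by apply: path_on_level => //; [exact/lt0r_neq0/exprn_gt0 | ring].
Qed.

Lemma exists_level_zero (R : realType) (r12 r23 r31 a1 a2 a3 k : R) :
  0 < a1 -> 0 < a2 -> 0 <= a3 -> a3 <= a1 -> a3 <= a2 ->
  exists m n c d, on_level a1 a2 a3 m n c d /\
    cross_term r12 r23 r31 a1 a2 a3 k m n c d = 0.
Proof.
move=> a1_gt0 a2_gt0 a3_ge0 a31 a32; apply: contrapT => no_zero.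
have neq0 m n c d : on_level a1 a2 a3 m n c d ->
    cross_term r12 r23 r31 a1 a2 a3 k m n c d != 0.
  by move=> lev; apply/eqP => x0; apply: no_zero; exists m, n, c, d.
have neq0N m n c d : on_level a1 a2 a3 m n c d ->
    cross_term r12 r23 r31 a1 a2 a3 (- k) m n c d != 0.
  by move=> /on_level_conj /neq0; rewrite cross_term_conj.
have w2_gt0 : 0 < a2 * (a1 + a3) by rewrite mulr_gt0 ?ltr_wpDr.
have w1_gt0 : 0 < a1 * (a2 + a3) by rewrite mulr_gt0 ?ltr_wpDr.
(* Minimality of [a3] gives these bounds, which provide the points with [s = 1] and with [u = s]. *)
have ha2 : a1 * a3 <= a2 * (a1 + a3) by nra.
have ha1 : a2 * a3 <= a1 * (a2 + a3) by nra.
have a13_ge0 : 0 <= a1 * a3 by rewrite mulr_ge0 // ltW.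
have a23_ge0 : 0 <= a2 * a3 by rewrite mulr_ge0 // ltW.
pose m0 := (- (a1 * a3)) / (a2 * (a1 + a3)).
pose n0 := Num.sqrt (1 - m0 ^+ 2).
have defm0 : a2 * (a1 + a3) * m0 = - (a1 * a3) by rewrite mulrC divfK ?lt0r_neq0.
have mn0 : m0 ^+ 2 + n0 ^+ 2 = 1.
  by apply: sqr_sqrt1B; rewrite // normrN ger0_norm.
have lev2 : on_level a1 a2 a3 m0 n0 1 0.
  split=> //; first by ring.
  by move: defm0; lra.
pose X := cross_term r12 r23 r31 a1 a2 a3 k m0 n0 1 0.
pose Y := cross_term r12 r23 r31 a1 a2 a3 k m0 (- n0) 1 0.
have sgnX m n c d : on_level a1 a2 a3 m n c d ->
    0 <= n * (a1 + a3 * c) - m * (a3 * d) ->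
    0 < cross_term r12 r23 r31 a1 a2 a3 k m n c d * X.
  by move=> lev w; exact: same_sign_as_base.
(* The other sheet is reached by conjugation, which amounts to replacing [k] by [- k]. *)
have sgnY m n c d : on_level a1 a2 a3 m n c d ->
    n * (a1 + a3 * c) - m * (a3 * d) <= 0 ->
    0 < cross_term r12 r23 r31 a1 a2 a3 k m n c d * Y.
  move=> lev w.
  have w' : 0 <= - n * (a1 + a3 * c) - m * (a3 * - d) by lra.
  have := same_sign_as_base a1_gt0 a2_gt0 a3_ge0 ha2 neq0N (on_level_conj lev) w' defm0.
  by rewrite !cross_term_conj !opprK oppr0.
(* At [s = -1] the level equation reads [b * Re u = a1 * a3]. *)
pose b := a2 * (a1 - a3).
pose mQ := (a1 * a3) / b; pose nQ := Num.sqrt (1 - mQ ^+ 2).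
have levQ : a1 * a3 <= b -> on_level a1 a2 a3 mQ nQ (- 1) 0 /\ 0 < b /\ b * mQ = a1 * a3.
  move=> le_b.
  have b_gt0 : 0 < b.
    move: a3_ge0; rewrite le_eqVlt => /predU1P[a30|a3_gt0].
      by rewrite /b -a30 subr0 mulr_gt0.
    by apply: lt_le_trans le_b; rewrite mulr_gt0.
  have defmQ : b * mQ = a1 * a3 by rewrite mulrC divfK // lt0r_neq0.
  split=> //; split; last 2 first.
  - by ring.
  - by move: defmQ; rewrite /b; lra.
  by apply: sqr_sqrt1B; rewrite // ger0_norm.
have XY : 0 < X * Y.
  (* If [b <= a1 * a3], the sheets meet, and the value at a common point has the signs of both [X]
     and [Y]. *)
  have [|le_b] := leP b (a1 * a3).
    move=> /(on_level_aligned a1_gt0 a2_gt0 a3_ge0 a31)[m [n [c [d [lev w0]]]]].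
    have := sgnX _ _ _ _ lev; have := sgnY _ _ _ _ lev; rewrite w0 lexx.
    move=> /(_ isT) sY /(_ isT) sX; have := mulr_gt0 sX sY.
    rewrite mulrACA pmulr_rgt0 //.
    by rewrite -expr2 exprn_even_gt0 //=; exact: neq0.
  have [lev [b_gt0 defmQ]] := levQ (ltW le_b).
  have nQ_ge0 : 0 <= nQ by exact: sqrtr_ge0.
  have n0_ge0 : 0 <= n0 by exact: sqrtr_ge0.
  have a13 : 0 <= a1 - a3 by rewrite subr_ge0.
  have a13' : 0 <= a1 + a3 by rewrite addr_ge0 // ltW.
  have wQ : 0 <= nQ * (a1 + a3 * -1) - mQ * (a3 * 0) by nra.
  have wQ' : - nQ * (a1 + a3 * -1) - mQ * (a3 * - 0) <= 0 by nra.
  have := sgnX _ _ _ _ lev wQ; have := sgnY _ _ _ _ (on_level_conj lev) wQ'.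
  have p1 := mulr_ge0 a13 n0_ge0; have p2 := mulr_ge0 a13' nQ_ge0.
  have X0 : X != 0 by exact: neq0.
  have Y0 : Y != 0 by have := neq0 _ _ _ _ (on_level_conj lev2); rewrite oppr0.
  (* [B] has the sign of [X], and [A] that of [Y]. If [X] and [Y] had opposite signs, [X - Y] and
     [B - A] would be nonzero of the same sign, but [k] enters them with opposite signs. *)
  have dXY : X - Y = - 2 * k * ((a1 - a3) * n0) by rewrite /X /Y /cross_term; ring.
  set A := cross_term _ _ _ _ _ _ _ _ _ _ _; set B := cross_term _ _ _ _ _ _ _ _ _ _ _.
  have dBA : B - A = 2 * k * ((a1 + a3) * nQ) by rewrite /A /B /cross_term; ring.
  move: (_ * n0) (_ * nQ) p1 p2 dXY dBA X0 Y0; clear.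
  move: A B X Y => A B X Y s t s0 t0 dXY dBA X0 Y0.
  case: (ltrgtP 0 X) X0 => // hX _; case: (ltrgtP 0 Y) Y0 => // hY _ hA hB;
    try by nra.
  - have hA' : A < 0 by nra.
    have hB' : 0 < B by nra.
    have [k0|k0] := leP 0 k; nra.
  - have hA' : 0 < A by nra.
    have hB' : B < 0 by nra.
    have [k0|k0] := leP 0 k; nra.
have sgn m n c d : on_level a1 a2 a3 m n c d ->
    0 < (r12 * m + r23 * (m * c + n * d) + r31 * c) * X.
  have sX m' n' c' d' : on_level a1 a2 a3 m' n' c' d' ->
      0 < cross_term r12 r23 r31 a1 a2 a3 k m' n' c' d' * X.
    move=> lev.
    have [w|/ltW w] := leP 0 (n' * (a1 + a3 * c') - m' * (a3 * d')); first exact: sgnX.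
    have sY := sgnY _ _ _ _ lev w.
    have := mulr_gt0 sY XY; rewrite [X * Y]mulrC mulrACA mulrA -[_ * Y * Y]mulrA.
    rewrite mulrAC pmulr_lgt0 // -expr2 exprn_even_gt0 //=.
    by apply/eqP => Y0; move: XY; rewrite Y0 mulr0 ltxx.
  (* Adding the values at conjugate points cancels the terms in [k]. *)
  move=> lev; have := sX _ _ _ _ lev; have := sX _ _ _ _ (on_level_conj lev).
  by rewrite /cross_term; lra.
(* The point with [u = s]: there [u conj(s) = 1], and the level equation determines [Re s]. *)
pose c1 := (- (a2 * a3)) / (a1 * (a2 + a3)).
pose d1 := Num.sqrt (1 - c1 ^+ 2).
have defc1 : a1 * (a2 + a3) * c1 = - (a2 * a3) by rewrite mulrC divfK ?lt0r_neq0.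
have cd1 : c1 ^+ 2 + d1 ^+ 2 = 1.
  by apply: sqr_sqrt1B; rewrite // normrN ger0_norm.
have lev1 : on_level a1 a2 a3 c1 d1 c1 d1.
  by split=> //; rewrite -!expr2 cd1; move: defc1; lra.
have R1 := mulr_gt0 w1_gt0 (sgn _ _ _ _ lev1).
have {}R1 : 0 < (a1 * (a2 + a3) * r23 - a2 * a3 * (r12 + r31)) * X.
  by move: R1; rewrite -!expr2 cd1 -[- (_ * (r12 + r31))]mulNr -defc1; lra.
have R2 := mulr_gt0 w2_gt0 (sgn _ _ _ _ lev2).
have {}R2 : 0 < (a2 * (a1 + a3) * r31 - a1 * a3 * (r12 + r23)) * X.
  by move: R2; rewrite -[- (_ * (r12 + r23))]mulNr -defm0; lra.
have [le_b|lt_b] := leP (a1 * a3) b.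
  have [lev [b_gt0 defmQ]] := levQ le_b.
  have RQ := mulr_gt0 b_gt0 (sgn _ _ _ _ lev).
  have {}RQ : 0 < (a1 * a3 * (r12 - r23) - b * r31) * X.
    by move: RQ; rewrite -defmQ; lra.
  have a12_gt0 : 0 < a1 * a2 by rewrite mulr_gt0.
  (* The forms in [RQ], [R2], [R1] sum to zero with weights [q1], [q2], [2 * (a1 * a3)]. *)
  have q1 : 0 < a1 * a2 + a1 * a3 + a2 * a3 by lra.
  have q2 : 0 <= a1 * a2 + a1 * a3 - a2 * a3 by nra.
  have := mulr_gt0 q1 RQ; have := mulr_ge0 q2 (ltW R2).
  by have := mulr_ge0 a13_ge0 (ltW R1); rewrite /b; lra.
have a3_gt0 : 0 < a3.
  rewrite lt_neqAle a3_ge0 andbT; apply/eqP => a30.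
  by move: lt_b; rewrite /b -a30 subr0 mulr0 ltNge ltW // mulr_gt0.
pose w3 := a3 * (a1 + a2); have w3_gt0 : 0 < w3 by rewrite mulr_gt0 ?addr_gt0.
(* The point with [u = 1]; [lt_b] ensures [|c3| <= 1]. *)
pose c3 := (- (a1 * a2)) / w3; pose d3 := Num.sqrt (1 - c3 ^+ 2).
have defc3 : w3 * c3 = - (a1 * a2) by rewrite mulrC divfK ?lt0r_neq0.
have a12_ge0 : 0 <= a1 * a2 by rewrite mulr_ge0 // ltW.
have lev3 : on_level a1 a2 a3 1 0 c3 d3.
  split; first by ring.
  - apply: sqr_sqrt1B; rewrite // normrN ger0_norm //.
    by move: lt_b; rewrite /b /w3; lra.
  - by move: defc3; rewrite /w3; lra.
have R3 := mulr_gt0 w3_gt0 (sgn _ _ _ _ lev3).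
have {}R3 : 0 < (w3 * r12 - a1 * a2 * (r23 + r31)) * X.
  by move: R3; rewrite -[- (_ * (r23 + r31))]mulNr -defc3; lra.
(* The forms in [R1], [R2], [R3] add up to zero identically. *)
by move: R1 R2 R3; rewrite /w3; lra.
Qed.

(** * Reduction of two orthogonal complex rows to the real case *)

Definition sqnorm (R : realType) (z : R[i]) : R :=
  complex.Re z ^+ 2 + complex.Im z ^+ 2.

Lemma sqnormM (R : realType) (z w : R[i]) :
  sqnorm (z * w) = sqnorm z * sqnorm w.
Proof. by case: z => a b; case: w => c d; rewrite /sqnorm /=; ring. Qed.

Lemma sqnorm_eq0 (R : realType) (z : R[i]) : sqnorm z = 0 -> z = 0.
Proof.
case: z => a b /eqP; rewrite /sqnorm /= paddr_eq0 ?sqr_ge0 //.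
by rewrite !sqrf_eq0 => /andP[/eqP -> /eqP ->].
Qed.

Lemma norm_eq1_sqnorm (R : realType) (z : R[i]) : `|z| = 1 <-> sqnorm z = 1.
Proof.
have zE : `|z| ^+ 2 = (sqnorm z)%:C%C by rewrite -add_Re2_Im2.
split=> [z1|z1]; first by apply: complexI; rewrite -zE z1 expr1n.
by apply/eqP; rewrite -(@pexpr_eq1 _ _ 2) // zE z1.
Qed.

Lemma exists_unit_orthogonal (R : realType) (p q : R) :
  exists c d, c ^+ 2 + d ^+ 2 = 1 /\ p * c + q * d = 0.
Proof.
have [s0|s0] := eqVneq (p ^+ 2 + q ^+ 2) 0.
  have [p0 q0] : p = 0 /\ q = 0.
    move/eqP: s0; rewrite paddr_eq0 ?sqr_ge0 // !sqrf_eq0.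
    by case/andP=> /eqP -> /eqP ->.
  by exists 1, 0; rewrite p0 q0; split; ring.
have s2 : Num.sqrt (p ^+ 2 + q ^+ 2) ^+ 2 = p ^+ 2 + q ^+ 2.
  by rewrite sqr_sqrtr // addr_ge0 ?sqr_ge0.
exists (q / Num.sqrt (p ^+ 2 + q ^+ 2)), (- p / Num.sqrt (p ^+ 2 + q ^+ 2)).
split; last by ring.
by rewrite !expr_div_n s2; field.
Qed.

(** For a row of a unitary matrix the right side is [1]. *)
Definition balanced (R : realType) (b1 b2 b3 y1 y2 y3 : R[i]) : Prop :=
  sqnorm (b1 * y1 + b2 * y2 + b3 * y3) = sqnorm b1 + sqnorm b2 + sqnorm b3.

Lemma balanced_C12 (R : realType) (b1 b2 b3 y1 y2 y3 : R[i]) :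
  balanced b2 b1 b3 y2 y1 y3 -> balanced b1 b2 b3 y1 y2 y3.
Proof. by rewrite /balanced [b2 * y2 + _]addrC [sqnorm b2 + _]addrC. Qed.

Lemma balanced_C23 (R : realType) (b1 b2 b3 y1 y2 y3 : R[i]) :
  balanced b1 b3 b2 y1 y3 y2 -> balanced b1 b2 b3 y1 y2 y3.
Proof. by rewrite /balanced addrAC [_ + sqnorm b2]addrAC. Qed.

Definition balanceable (R : realType) (a1 a2 a3 b1 b2 b3 : R[i]) : Prop :=
  exists y1 y2 y3, [/\ sqnorm y1 = 1, sqnorm y2 = 1, sqnorm y3 = 1,
    balanced a1 a2 a3 y1 y2 y3 & balanced b1 b2 b3 y1 y2 y3].

Lemma balanceable_C12 (R : realType) (a1 a2 a3 b1 b2 b3 : R[i]) :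
  balanceable a2 a1 a3 b2 b1 b3 -> balanceable a1 a2 a3 b1 b2 b3.
Proof.
case=> y1 [y2 [y3 [h1 h2 h3 /balanced_C12 ha /balanced_C12 hb]]].
by exists y2, y1, y3.
Qed.

Lemma balanceable_C23 (R : realType) (a1 a2 a3 b1 b2 b3 : R[i]) :
  balanceable a1 a3 a2 b1 b3 b2 -> balanceable a1 a2 a3 b1 b2 b3.
Proof.
case=> y1 [y2 [y3 [h1 h2 h3 /balanced_C23 ha /balanced_C23 hb]]].
by exists y1, y3, y2.
Qed.

(** Every torus vector balances the first row, and orthogonality forces [b1 = 0]. It remains to
    choose [s] with [Re (b2 conj(b3 s)) = 0]. *)
Lemma balanceable_of_single (R : realType) (a1 : R) (b1 b2 b3 : R[i]) :
  a1 != 0 -> a1%:C%C * b1 = 0 -> balanceable a1%:C%C 0 0 b1 b2 b3.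
Proof.
move=> a10 /eqP; rewrite mulf_eq0 -[0]/(0%:C%C) (inj_eq (@complexI R)) (negPf a10).
move=> /eqP ->; case: b2 b3 => [e2 f2] [e3 f3].
have [c [d [cd pq]]] :=
  exists_unit_orthogonal (e2 * e3 + f2 * f3) (f2 * e3 - e2 * f3).
exists 1, 1, (Complex c d); split; rewrite ?/balanced /sqnorm /=; try by ring.
- exact: cd.
- have := congr1 (fun t : R => 2 * t) pq.
  have := congr1 (fun t : R => t * (e3 ^+ 2 + f3 ^+ 2)) cd.
  by move=> /= cd' pq'; lra.
Qed.

Lemma balanceable_of_min (R : realType) (a1 a2 a3 : R) (b1 b2 b3 : R[i]) :
  0 < a1 -> 0 < a2 -> 0 <= a3 -> a3 <= a1 -> a3 <= a2 ->
  a1%:C%C * b1 + a2%:C%C * b2 + a3%:C%C * b3 = 0 ->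
  balanceable a1%:C%C a2%:C%C a3%:C%C b1 b2 b3.
Proof.
case: b1 b2 b3 => [e1 f1] [e2 f2] [e3 f3] a1_gt0 a2_gt0 a3_ge0 a31 a32 orth.
have oe : a1 * e1 + a2 * e2 + a3 * e3 = 0.
  by have := congr1 (@complex.Re R) orth; rewrite /=; lra.
have of_ : a1 * f1 + a2 * f2 + a3 * f3 = 0.
  by have := congr1 (@complex.Im R) orth; rewrite /=; lra.
have a10 := lt0r_neq0 a1_gt0.
(* The imaginary part [f] and the real part [e] of [b] are orthogonal to [a], so the cross product
   of [f] and [e] is [k] times [a]. *)
pose k := (f2 * e3 - e2 * f3) / a1.
have I23 : f2 * e3 - e2 * f3 = k * a1 by rewrite divfK.
have I12 : f1 * e2 - e1 * f2 = k * a3.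
  apply: (mulfI a10).
  transitivity (a3 * (f2 * e3 - e2 * f3)); last by rewrite I23; ring.
  have E : a1 * f1 = - (a2 * f2 + a3 * f3) by lra.
  have F : a1 * e1 = - (a2 * e2 + a3 * e3) by lra.
  transitivity (a1 * f1 * e2 - a1 * e1 * f2); first by ring.
  by rewrite E F; ring.
have I31 : f3 * e1 - e3 * f1 = k * a2.
  apply: (mulfI a10).
  transitivity (a2 * (f2 * e3 - e2 * f3)); last by rewrite I23; ring.
  have E : a1 * f1 = - (a2 * f2 + a3 * f3) by lra.
  have F : a1 * e1 = - (a2 * e2 + a3 * e3) by lra.
  transitivity (f3 * (a1 * e1) - e3 * (a1 * f1)); first by ring.
  by rewrite E F; ring.
have [m [n [c [d [[mn cd E] X0]]]]] := exists_level_zero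
  (e1 * e2 + f1 * f2) (e2 * e3 + f2 * f3) (e3 * e1 + f3 * f1) k
  a1_gt0 a2_gt0 a3_ge0 a31 a32.
exists 1, (Complex m n), (Complex c d).
split; rewrite ?/balanced /sqnorm //=; first by ring.
- transitivity (a1 ^+ 2 + a2 ^+ 2 * (m ^+ 2 + n ^+ 2) + a3 ^+ 2 * (c ^+ 2 + d ^+ 2)
    + 2 * (a1 * a2 * m + a2 * a3 * (m * c + n * d) + a1 * a3 * c)); first by ring.
  by rewrite mn cd E; ring.
- transitivity (e1 ^+ 2 + f1 ^+ 2 + (e2 ^+ 2 + f2 ^+ 2) * (m ^+ 2 + n ^+ 2)
    + (e3 ^+ 2 + f3 ^+ 2) * (c ^+ 2 + d ^+ 2)
    + 2 * ((e1 * e2 + f1 * f2) * m + (e2 * e3 + f2 * f3) * (m * c + n * d)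
      + (e3 * e1 + f3 * f1) * c - ((f2 * e3 - e2 * f3) * (n * c - m * d)
      + (f3 * e1 - e3 * f1) * d - (f1 * e2 - e1 * f2) * n))); first by ring.
  rewrite mn cd I23 I31 I12.
  by move: X0; rewrite /cross_term; lra.
Qed.

(** A permutation of the columns puts the smallest entry last. If another entry vanishes, so does
    the smallest, and only one nonzero entry is left. *)
Lemma balanceable_of_ge0 (R : realType) (a1 a2 a3 : R) (b1 b2 b3 : R[i]) :
  0 <= a1 -> 0 <= a2 -> 0 <= a3 -> a1 ^+ 2 + a2 ^+ 2 + a3 ^+ 2 != 0 ->
  a1%:C%C * b1 + a2%:C%C * b2 + a3%:C%C * b3 = 0 ->
  balanceable a1%:C%C a2%:C%C a3%:C%C b1 b2 b3.
Proof.
have last_min (x1 x2 x3 : R) (z1 z2 z3 : R[i]) :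
    0 <= x1 -> 0 <= x2 -> 0 <= x3 -> x1 ^+ 2 + x2 ^+ 2 + x3 ^+ 2 != 0 ->
    x3 <= x1 -> x3 <= x2 -> x1%:C%C * z1 + x2%:C%C * z2 + x3%:C%C * z3 = 0 ->
    balanceable x1%:C%C x2%:C%C x3%:C%C z1 z2 z3.
  rewrite le_eqVlt => /predU1P[<- _ x3_ge0 x0 x31 x32|x1_gt0].
    have x30 : x3 = 0 by apply/eqP; rewrite eq_le x31.
    move: x0; rewrite x30 expr0n /= add0r addr0 sqrf_eq0 => x20.
    rewrite !mul0r add0r addr0 => orth.
    exact/balanceable_C12/balanceable_of_single.
  rewrite le_eqVlt => /predU1P[<- x3_ge0 _ x31 x32|x2_gt0 x3_ge0 _ x31 x32 orth].
    have -> : x3 = 0 by apply/eqP; rewrite eq_le x32.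
    rewrite !mul0r !addr0 => orth.
    by apply: balanceable_of_single => //; exact: lt0r_neq0.
  exact: balanceable_of_min.
move=> a1_ge0 a2_ge0 a3_ge0 a0 orth.
have [le12|/ltW le21] := leP a1 a2.
- have [le31|/ltW le13] := leP a3 a1.
    by apply: last_min => //; exact: le_trans le12.
  apply/balanceable_C12/balanceable_C23/last_min => //.
    by rewrite addrC addrA.
  by rewrite -orth; ring.
- have [le32|/ltW le23] := leP a3 a2.
    by apply: last_min => //; exact: le_trans le21.
  by apply/balanceable_C23/last_min => //; rewrite addrAC.
Qed.

Lemma exists_phase (R : realType) (z : R[i]) :
  exists (u : R[i]) (r : R), [/\ sqnorm u = 1, 0 <= r & z * u = r%:C%C].
Proof.
have [->|z0] := eqVneq z 0.
  by exists 1, 0; split; rewrite ?mul0r // /sqnorm /=; ring.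
have s0 : sqnorm z != 0 by apply: contra_neq z0; exact: sqnorm_eq0.
have s_ge0 : 0 <= sqnorm z by rewrite addr_ge0 ?sqr_ge0.
pose r := Num.sqrt (sqnorm z).
have r2 : r ^+ 2 = sqnorm z by rewrite sqr_sqrtr.
have r0 : r != 0 by apply: contra_neq s0 => r0; rewrite -r2 r0 expr0n.
exists (Complex (complex.Re z / r) (- complex.Im z / r)), r.
split; last 1 first.
- clear z0; case: z r r0 r2 {s0 s_ge0} => a b r r0; rewrite /sqnorm /= => r2.
  apply/eqP; rewrite eq_complex /=; apply/andP; split; apply/eqP.
    transitivity ((a ^+ 2 + b ^+ 2) / r); first by ring.
    by rewrite -r2; field.
  by ring.
- transitivity (sqnorm z / r ^+ 2); first by rewrite /sqnorm /=; field.
  by rewrite r2 divff.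
- exact: sqrtr_ge0.
Qed.

(** Column phases make the first row real and nonnegative. Applied to both rows, they preserve
    orthogonality and can be absorbed into the torus vector. *)
Lemma balanceable_of_orthogonal (R : realType) (a1 a2 a3 b1 b2 b3 : R[i]) :
  sqnorm a1 + sqnorm a2 + sqnorm a3 != 0 ->
  (a1^*)%C * b1 + (a2^*)%C * b2 + (a3^*)%C * b3 = 0 ->
  balanceable a1 a2 a3 b1 b2 b3.
Proof.
have [u1 [r1 [hu1 r1_ge0 E1]]] := exists_phase a1.
have [u2 [r2 [hu2 r2_ge0 E2]]] := exists_phase a2.
have [u3 [r3 [hu3 r3_ge0 E3]]] := exists_phase a3.
have sq (a u : R[i]) (r : R) : a * u = r%:C%C -> sqnorm u = 1 -> sqnorm a = r ^+ 2.
  by move=> E hu; rewrite -[LHS]mulr1 -hu -sqnormM E /sqnorm /=; ring.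
have cj (a u : R[i]) (r : R) (b : R[i]) : a * u = r%:C%C -> sqnorm u = 1 ->
      (a^*)%C * b = r%:C%C * (b * u).
  move=> E hu; have uu : (u^*)%C * u = 1.
    by apply/eqP; move: hu; case: u {E} => c d; rewrite /sqnorm /= eq_complex /= => hu;
      apply/andP; split; apply/eqP; lra.
  have -> : r%:C%C = (a^*)%C * (u^*)%C by rewrite -rmorphM /= E conjc_real.
  by transitivity ((a^*)%C * b * ((u^*)%C * u)); [rewrite uu mulr1 | ring].
rewrite (sq _ _ _ E1 hu1) (sq _ _ _ E2 hu2) (sq _ _ _ E3 hu3).
rewrite (cj _ _ _ b1 E1 hu1) (cj _ _ _ b2 E2 hu2) (cj _ _ _ b3 E3 hu3).
move=> /balanceable_of_ge0 h /(h _ _ _ r1_ge0 r2_ge0 r3_ge0).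
case=> y1 [y2 [y3 [hy1 hy2 hy3 ha hb]]].
exists (u1 * y1), (u2 * y2), (u3 * y3); split; rewrite ?sqnormM ?hu1 ?hu2 ?hu3 ?mul1r //.
- by move: ha; rewrite /balanced -E1 -E2 -E3 !sqnormM hu1 hu2 hu3 !mulr1 !mulrA.
- by move: hb; rewrite /balanced !sqnormM hu1 hu2 hu3 !mulr1 !mulrA.
Qed.

(** * Unitary matrices and the conclusion *)

Lemma sqnormE (R : realType) (z : R[i]) : (sqnorm z)%:C%C = Num.conj z * z.
Proof.
by rewrite mulrC -normCK -add_Re2_Im2.
Qed.

Lemma unitarymx_sum_sqnorm (R : realType) (n : nat)
    (A : 'M[R[i]]_n) (v : 'cV[R[i]]_n) :
  A \is unitarymx -> \sum_i sqnorm ((A *m v) i 0) = \sum_i sqnorm (v i 0).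
Proof.
move=> hA; apply: complexI; rewrite !rmorph_sum /=.
have e (w : 'cV[R[i]]_n) :
    \sum_i (sqnorm (w i 0))%:C%C = (map_mx Num.conj w^T *m w) 0 0.
  by rewrite mxE; apply: eq_bigr => i _; rewrite sqnormE !mxE.
by rewrite !e trmx_mul map_mxM mulmxA mulmxKtV.
Qed.

Lemma row_unitarymx_orthonormal (R : realType) (n : nat)
    (A : 'M[R[i]]_n) (i j : 'I_n) :
  A \is unitarymx -> \sum_k ((A i k)^*)%C * A j k = (j == i)%:R.
Proof.
move=> /unitarymxP /(congr1 (fun M : 'M_n => M j i)); rewrite !mxE => <-.
by apply: eq_bigr => k _; rewrite !mxE mulrC.
Qed.

Lemma sum_ord3 (V : nmodType) (F : 'I_3 -> V) :
  \sum_k F k = F 0 + F 1 + F (inord 2).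
Proof.
rewrite !big_ord_recl big_ord0 addr0 addrA.
by congr (_ + F _ + F _); apply: val_inj; rewrite /= ?inordK.
Qed.

Theorem theorem6p3 (R : realType) (A : 'M[R[i]]_3) (hA : A \is unitarymx) :
  exists v : 'cV[R[i]]_3, biunimodular A v.
Proof.
have ord3 (P : 'I_3 -> Prop) : P 0 -> P 1 -> P (inord 2) -> forall k, P k.
  move=> h0 h1 h2 [[|[|[|//]]] hk].
  - by have -> : Ordinal hk = 0 by exact: val_inj.
  - by have -> : Ordinal hk = 1 by exact: val_inj.
  - by have -> : Ordinal hk = inord 2 by apply: val_inj; rewrite /= inordK.
have row_norm i : sqnorm (A i 0) + sqnorm (A i 1) + sqnorm (A i (inord 2)) = 1.
  rewrite -(sum_ord3 (fun k => sqnorm (A i k))); apply: complexI.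
  have -> : (1%:C%C : R[i]) = (i == i)%:R by rewrite eqxx.
  rewrite rmorph_sum /= -(row_unitarymx_orthonormal i i hA).
  by apply: eq_bigr => k _; exact: sqnormE.
have := row_unitarymx_orthonormal 0 1 hA; rewrite sum_ord3 /= => orth.
have [|y0 [y1 [y2 [h0 h1 h2]]]] := balanceable_of_orthogonal _ orth.
  by rewrite row_norm oner_neq0.
rewrite /balanced !row_norm => b0 b1.
pose v : 'cV[R[i]]_3 := \col_k [:: y0; y1; y2]`_k.
have v0 : v 0 0 = y0 by rewrite mxE.
have v1 : v 1 0 = y1 by rewrite mxE.
have v2 : v (inord 2) 0 = y2 by rewrite mxE inordK.
have Av i : (A *m v) i 0 = A i 0 * y0 + A i 1 * y1 + A i (inord 2) * y2.
  by rewrite mxE sum_ord3 v0 v1 v2.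
exists v; split; apply: ord3; apply/norm_eq1_sqnorm; rewrite ?v0 ?v1 ?v2 ?Av //.
(* Only the third entry of [A *m v] is left; it follows from [|A v|^2 = |v|^2 = 3]. *)
have := unitarymx_sum_sqnorm v hA.
by rewrite !sum_ord3 !Av v0 v1 v2 h0 h1 h2 b0 b1; exact: addrI.
Qed.
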